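(* Let $\Gamma=(m_{i,j})_{i,j\in I}$ be a Coxeter matrix of small type, $G$ a subgroup of $\mathrm{Aut}(\Gamma)$, $\mathfrak R$ a commutative unitary ring, $(\mathfrak b,\mathfrak c,\mathfrak d)\in(\mathfrak R^\times)^3$, $(f_i)_{i\in I}$ an LK-family relatively to $(\mathfrak b,\mathfrak c,\mathfrak d)$, and $\psi:B^+\to\mathscr L(V)$, $b\mapsto\psi_b$, the associated LK-representation. Put $\mathfrak f_{i,\alpha}=f_i(e_\alpha)$ and assume $\mathfrak f_{i,\alpha}=\mathfrak f_{g(i),g(\alpha)}$ for every $(i,\alpha,g)\in I\times\Phi^+\times G$. Then for every $(b,v,g)\in B^+\times V\times G$ we have $g(\psi_b(v))=\psi_{g(b)}(g(v))$. In particular, for every $b\in(B^+)^G$, $\psi_b$ stabilizes $V^G$, and hence $\psi$ induces a linear representation $$\psi^G:(B^+)^G\to\mathscr L(V^G),\qquad b\mapsto\psi^G_b=\psi_b|_{V^G}.$$ Moreover, if all the images of $\psi$ are invertible (in $\mathscr L(V)$), then all the images of $\psi^G$ are invertible (in $\mathscr L(V^G)$).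
   Context: A Coxeter matrix of small type is $\Gamma=(m_{i,j})_{i,j\in I}$ with $I$ finite, $m_{i,j}=m_{j,i}\in\{1,2,3\}$ and $m_{i,j}=1\Leftrightarrow i=j$. Its Artin-Tits monoid $B^+$ is the monoid with generators $\mathbf s_i$ ($i\in I$) and relations $\mathbf s_i\mathbf s_j=\mathbf s_j\mathbf s_i$ if $m_{i,j}=2$, $\mathbf s_i\mathbf s_j\mathbf s_i=\mathbf s_j\mathbf s_i\mathbf s_j$ if $m_{i,j}=3$. Let $E=\bigoplus_{i\in I}\mathbb R\alpha_i$ with the symmetric bilinear form $(\alpha_i|\alpha_j)=-2\cos(\pi/m_{i,j})$. The Coxeter group $W$, with generators $s_i$, acts on $E$ by $s_i(\beta)=\beta-(\beta|\alpha_i)\alpha_i$. Put $\Phi=\{w(\alpha_i)\mid w\in W,i\in I\}$, $\Phi^+$ = the elements of $\Phi$ with non-negative coordinates in $(\alpha_i)$, $\Phi^-=-\Phi^+$. The depth of $\alpha\in\Phi^+$ is $\mathrm{dp}(\alpha)=\min\{l(w)\mid w\in W,\ w(\alpha)\in\Phi^-\}$, $l$ being word length in the $s_i$. $V$ is the free $\mathfrak R$-module with basis $(e_\alpha)_{\alpha\in\Phi^+}$; $\mathscr L(V)$ its endomorphisms. Set $\mathfrak a=\mathfrak d-\mathfrak b\mathfrak c/\mathfrak d$. For $i\in I$, $\varphi_i\in\mathscr L(V)$ is given by: $\varphi_i(e_{\alpha_i})=0$; $\varphi_i(e_\alpha)=\mathfrak d e_\alpha$ if $s_i(\alpha)=\alpha$;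 and if $\alpha,\beta\in\Phi^+$, $\beta=s_i(\alpha)$, $\mathrm{dp}(\beta)>\mathrm{dp}(\alpha)$, then $\varphi_i(e_\beta)=\mathfrak b e_\alpha$, $\varphi_i(e_\alpha)=\mathfrak a e_\alpha+\mathfrak c e_\beta$. An LK-family relatively to $(\mathfrak b,\mathfrak c,\mathfrak d)$ is $(f_i)_{i\in I}\in(V^\star)^I$ such that: $f_i(e_{\alpha_j})=0$ for $i\neq j$; $f_i\varphi_j=\mathfrak d f_i$ if $m_{i,j}=2$; $f_i\varphi_j=f_j\varphi_i$ if $m_{i,j}=3$. The associated LK-representation is the monoid homomorphism $\psi:B^+\to\mathscr L(V)$ with $\psi_{\mathbf s_i}(v)=\varphi_i(v)+f_i(v)e_{\alpha_i}$. $\mathrm{Aut}(\Gamma)$ is the group of permutations $g$ of $I$ with $m_{g(i),g(j)}=m_{i,j}$. It acts on $B^+$ by $\mathbf s_i\mapsto\mathbf s_{g(i)}$, on $E$ linearly by $\alpha_i\mapsto\alpha_{g(i)}$ (stabilizing $\Phi^+$), and on $V$ by $e_\alpha\mapsto e_{g(\alpha)}$. $(B^+)^G$ and $V^G$ denote the fixed points of $G$. *)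

(* Defs.v *)
From HB Require Import structures.
From mathcomp Require Import all_boot all_order all_fingroup all_algebra.
From mathcomp Require Import all_classical all_reals.
From mathcomp Require Import ring lra.
From mathcomp Require Import generic_quotient sequences trigo.

Set Implicit Arguments.
Unset Strict Implicit.
Unset Printing Implicit Defensive.

Import Order.TTheory GRing.Theory Num.Theory.
Local Open Scope classical_set_scope.
Local Open Scope quotient_scope.
Local Open Scope ring_scope.

(* Monoids and groups given by generators and relations: [presented r] is the
   monoid generated by I subject to the relations s = t for all r s t. *)
Section Presentation.
Variables (I : finType) (r : seq I -> seq I -> Prop).

Inductive cong : seq I -> seq I -> Prop :=
| cong_rel u v s t : r s t -> cong (u ++ s ++ v) (u ++ t ++ v)
| cong_refl s : cong s s
| cong_sym s t : cong s t -> cong t s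
| cong_trans s t u : cong s t -> cong t u -> cong s u.

Lemma cong_cat s s' t t' : cong s s' -> cong t t' -> cong (s ++ t) (s' ++ t').
Proof.
move=> ss' tt'; apply: (@cong_trans _ (s' ++ t)).
  elim: ss' => {s s' t' tt'} [u v s s' rs|s|s s' _ IH|s s' s'' _ IH1 _ IH2].
  - by rewrite -!catA; apply: cong_rel.
  - exact: cong_refl.
  - exact: cong_sym.
  - exact: cong_trans IH1 IH2.
elim: tt' => {s ss' t t'} [u v s t rs|s|s t _ IH|s t u _ IH1 _ IH2].
- by rewrite !(catA s'); apply: cong_rel.
- exact: cong_refl.
- exact: cong_sym.
- exact: cong_trans IH1 IH2.
Qed.

Definition congb : rel (seq I) := fun s t => `[< cong s t >].

Lemma congb_refl : reflexive congb.
Proof. by move=> s; apply/asboolP/cong_refl. Qed.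

Lemma congb_sym : symmetric congb.
Proof. by move=> s t; apply/asboolP/asboolP; apply: cong_sym. Qed.

Lemma congb_trans : transitive congb.
Proof.
by move=> t s u /asboolP st /asboolP tu; apply/asboolP/(cong_trans st tu).
Qed.

Canonical congb_equiv := EquivRel congb congb_refl congb_sym congb_trans.

Definition presented := {eq_quot congb_equiv}.
HB.instance Definition _ := Choice.on presented.
HB.instance Definition _ := EqQuotient.on presented.

Definition pres_word (s : seq I) : presented := \pi_presented s.

Lemma pres_wordP s t : reflect (cong s t) (pres_word s == pres_word t).
Proof. by rewrite eqmodE; apply: asboolP. Qed.

Lemma cong_repr s : cong (repr (pres_word s)) s.
Proof. by apply/pres_wordP; rewrite /pres_word reprK. Qed.

Lemma pres_wordK (x : presented) : pres_word (repr x) = x.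
Proof. exact: reprK. Qed.

Definition pres_mul (x y : presented) := pres_word (repr x ++ repr y).

Lemma pres_mulE s t : pres_mul (pres_word s) (pres_word t) = pres_word (s ++ t).
Proof. by apply/eqP/pres_wordP/cong_cat; apply: cong_repr. Qed.

Lemma pres_mulA : associative pres_mul.
Proof.
move=> x y z; rewrite -(pres_wordK x) -(pres_wordK y) -(pres_wordK z).
by rewrite !pres_mulE catA.
Qed.

Lemma pres_mul1 : left_id (pres_word [::]) pres_mul.
Proof. by move=> x; rewrite -(pres_wordK x) pres_mulE. Qed.

Lemma pres_mulr1 : right_id (pres_word [::]) pres_mul.
Proof. by move=> x; rewrite -(pres_wordK x) pres_mulE cats0. Qed.

HB.instance Definition _ :=
  isMonoid.Build presented pres_mulA pres_mul1 pres_mulr1.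

Lemma pres_word_cat s t : pres_word (s ++ t) = (pres_word s * pres_word t)%g.
Proof. by rewrite [RHS]pres_mulE. Qed.

Definition pres_gen (i : I) : presented := pres_word [:: i].

End Presentation.

Record coxMatrix (I : finType) := CoxMatrix {
  cox_fun :> I -> I -> nat;
  cox_sym : forall i j, cox_fun i j = cox_fun j i;
  cox_small : forall i j, cox_fun i j \in [:: 1; 2; 3]%N;
  cox_diag : forall i j, cox_fun i j = 1%N <-> i = j }.

Section Groups.
Variables (I : finType) (m : coxMatrix I).

Inductive artin_rel : seq I -> seq I -> Prop :=
| artin_comm i j : m i j = 2%N -> artin_rel [:: i; j] [:: j; i]
| artin_braid i j : m i j = 3%N -> artin_rel [:: i; j; i] [:: j; i; j].

Definition artin := presented artin_rel.
HB.instance Definition _ := Monoid.on artin.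

Definition artin_gen (i : I) : artin := pres_gen artin_rel i.

(* The relations (s_i s_j)^(m_ij) = 1; those with i = j say s_i^2 = 1, so the
   monoid they present is already the Coxeter group. *)
Inductive cox_rel : seq I -> seq I -> Prop :=
| cox_rel_intro i j : cox_rel (flatten (nseq (m i j) [:: i; j])) [::].

Definition coxeter := presented cox_rel.
HB.instance Definition _ := Monoid.on coxeter.

Definition cox_word (s : seq I) : coxeter := pres_word cox_rel s.

Lemma cox_word_cat s t : cox_word (s ++ t) = (cox_word s * cox_word t)%g.
Proof. exact: pres_word_cat. Qed.

Definition cox_inv (w : coxeter) : coxeter := cox_word (rev (repr w)).

Lemma cox_word_rev s : (cox_word (rev s) * cox_word s)%g = 1%g.
Proof.
have gen2 i : (cox_word [:: i] * cox_word [:: i] = 1)%g.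
  rewrite -[LHS]pres_word_cat; apply/eqP/pres_wordP.
  have := cong_rel [::] [::] (cox_rel_intro i i).
  by rewrite (cox_diag m i i).2.
elim: s => [|i s IH]; first exact: mul1g.
rewrite rev_cons -cats1 -(cat1s i s) !cox_word_cat.
by rewrite mulgA -(mulgA (cox_word (rev s))) gen2 mulg1.
Qed.

Lemma cox_mulV : left_inverse 1%g cox_inv *%g.
Proof. by move=> w; rewrite -{2}(pres_wordK w) cox_word_rev. Qed.

Lemma cox_mulrV : right_inverse 1%g cox_inv *%g.
Proof.
by move=> w; rewrite -{1}(pres_wordK w) -{1}(revK (repr w)) cox_word_rev.
Qed.

HB.instance Definition _ := hasInv.Build coxeter cox_inv.
HB.instance Definition _ := Monoid_isGroup.Build coxeter cox_mulV cox_mulrV.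

Definition cox_has_word (w : coxeter) : pred nat :=
  fun n => `[< exists2 s, cox_word s = w & size s = n >].

Lemma cox_has_word_ex w : exists n, cox_has_word w n.
Proof.
by exists (size (repr w)); apply/asboolP; exists (repr w) => //; apply: pres_wordK.
Qed.

Definition cox_length (w : coxeter) : nat := ex_minn (cox_has_word_ex w).

(* The product of {perm I} composes left to right, (g * h) i = h (g i); this does
   not affect which subsets are subgroups. *)
Definition coxaut : {set {perm I}} :=
  [set g : {perm I} | [forall i, forall j, m (g i) (g j) == m i j]].

Lemma coxautP (g : {perm I}) :
  reflect (forall i j, m (g i) (g j) = m i j) (g \in coxaut).
Proof. by rewrite inE; apply: 'forall_'forall_eqP. Qed.

Lemma coxaut_group_set : group_set coxaut.
Proof.
apply/group_setP; split=> [|g h /coxautP gP /coxautP hP]; apply/coxautP => i j.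
  by rewrite !perm1.
by rewrite !permM hP gP.
Qed.
Canonical coxaut_group := Group coxaut_group_set.

Implicit Type g : [subg coxaut].

Lemma subg_coxautE g i j : m (sgval g i) (sgval g j) = m i j.
Proof. exact/coxautP/valP. Qed.

Definition aut_artin g (b : artin) : artin :=
  pres_word artin_rel (map (sgval g) (repr b)).

Lemma cong_map_artin g s t :
  cong artin_rel s t -> cong artin_rel (map (sgval g) s) (map (sgval g) t).
Proof.
elim=> {s t} [u v s t st|s|s t _ IH|s t u _ IH1 _ IH2].
- rewrite !map_cat; apply: cong_rel.
  by case: st => i j ij; constructor; rewrite subg_coxautE.
- exact: cong_refl.
- exact: cong_sym.
- exact: cong_trans IH1 IH2.
Qed.

Lemma aut_artin_word g s :
  aut_artin g (pres_word artin_rel s) = pres_word artin_rel (map (sgval g) s).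
Proof. by apply/eqP/pres_wordP/cong_map_artin/cong_repr. Qed.

Lemma aut_artin_is_monoid_morphism g : monoid.monoid_morphism (aut_artin g).
Proof.
split; first exact: aut_artin_word.
move=> x y; rewrite -(pres_wordK x) -(pres_wordK y) -pres_word_cat.
by rewrite !aut_artin_word map_cat pres_word_cat.
Qed.

HB.instance Definition _ g :=
  isUMagmaMorphism.Build artin artin (aut_artin g)
    (aut_artin_is_monoid_morphism g).

Lemma cong_map_cox g s t :
  cong cox_rel s t -> cong cox_rel (map (sgval g) s) (map (sgval g) t).
Proof.
elim=> {s t} [u v s t st|s|s t _ IH|s t u _ IH1 _ IH2].
- rewrite !map_cat; apply: cong_rel; case: st => i j.
  by rewrite map_flatten map_nseq -(subg_coxautE g).
- exact: cong_refl.
- exact: cong_sym.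
- exact: cong_trans IH1 IH2.
Qed.

Variable G : {group [subg coxaut]}.

Definition artin_fix : {pred artin} :=
  fun b => `[< forall g, g \in G -> aut_artin g b = b >].

Lemma artin_fix_closed : umagma_closed artin_fix.
Proof.
split=> [|x y /asboolP xG /asboolP yG]; apply/asboolP => g gG.
  exact: gmulf1.
by rewrite gmulfM/= (xG g gG) (yG g gG).
Qed.

Definition artin_fixed := {b : artin | artin_fix b}.
HB.instance Definition _ := SubChoice.on artin_fixed.
HB.instance Definition _ :=
  SubChoice_isSubMonoid.Build artin artin_fix artin_fixed artin_fix_closed.

End Groups.

Section Roots.
Variables (R : realType) (I : finType) (m : coxMatrix I).

Definition rootspace := {ffun I -> R^o}.
HB.instance Definition _ := GRing.Lmodule.on rootspace.

Implicit Types (x y : rootspace) (g : [subg coxaut m]).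

Definition alpha (i : I) : rootspace := [ffun j => (j == i)%:R].

Definition coeff (i j : I) : R := - 2 * cos (pi / (m i j)%:R).

Definition bform x y : R := \sum_i \sum_j x i * y j * coeff i j.

Definition refl (i : I) (x : rootspace) : rootspace :=
  x - bform x (alpha i) *: alpha i.

(* s_1 ... s_k acts by s_1 (... (s_k x)); cox_act_word shows that the choice of
   the representing word is irrelevant. *)
Definition cox_act (w : coxeter m) (x : rootspace) : rootspace :=
  foldr refl x (repr w).

Let scaleE (a b : R) : a *: (b : R^o) = a * b. Proof. by []. Qed.

Lemma rootspaceE x : x = \sum_i x i *: alpha i.
Proof.
apply/ffunP => j; rewrite sum_ffunE (bigD1 j) //= !ffunE eqxx scaleE mulr1.
by rewrite big1 ?addr0 // => i ij; rewrite !ffunE scaleE eq_sym (negPf ij) mulr0.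
Qed.

Lemma cos_pi3 : cos (pi / 3) = 2^-1 :> R.
Proof.
set c := cos _; have c0 : 0 < c.
  apply: cos_gt0_pihalf; have := pi_gt0 R; lra.
have E : (c + 1) * (2 * c - 1) ^+ 2 = 0.
  have := @cospi R; have -> : pi = pi / 3 *+ 2 + pi / 3 :> R.
    by rewrite mulr2n; lra.
  rewrite cosD cos_mulr2n sin_mulr2n -/c => H.
  have := sin2cos2 (pi / 3 : R); rewrite -/c => H2.
  move: H; set s := sin _ in H2 *; move=> H.
  have {}H : 4 * c ^+ 3 - 3 * c = - 1.
    rewrite -H; have -> : (c * s *+ 2) * s = 2 * c * s ^+ 2 by ring.
    by rewrite H2; ring.
  have -> : (c + 1) * (2 * c - 1) ^+ 2 = 4 * c ^+ 3 - 3 * c + 1 by ring.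
  by rewrite H addNr.
move/eqP: E; rewrite mulf_eq0 expf_eq0 /= => /orP[/eqP|/eqP]; lra.
Qed.

Lemma coeff1 i : coeff i i = 2.
Proof.
by rewrite /coeff (cox_diag m i i).2 // divr1 cospi mulrN1 opprK.
Qed.

Lemma coeff2 i j : m i j = 2%N -> coeff i j = 0.
Proof. by move=> e; rewrite /coeff e cos_pihalf mulr0. Qed.

Lemma coeff3 i j : m i j = 3%N -> coeff i j = -1.
Proof. by move=> e; rewrite /coeff e cos_pi3; lra. Qed.

Lemma coeff_sym i j : coeff i j = coeff j i.
Proof. by rewrite /coeff cox_sym. Qed.

Lemma bformE x i : bform x (alpha i) = \sum_j x j * coeff j i.
Proof.
apply: eq_bigr => j _; rewrite (bigD1 i) //= ffunE eqxx mulr1 big1 ?addr0 //.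
by move=> k ki; rewrite ffunE (negPf ki) mulr0 mul0r.
Qed.

Lemma bformBZ i x y a :
  bform (x - a *: y) (alpha i) = bform x (alpha i) - a * bform y (alpha i).
Proof.
rewrite !bformE mulr_sumr -sumrB; apply: eq_bigr => j _ /=.
by rewrite !ffunE scaleE; ring.
Qed.

Lemma bform_alpha i j : bform (alpha i) (alpha j) = coeff i j.
Proof.
rewrite bformE (bigD1 i) //= ffunE eqxx mul1r big1 ?addr0 // => k ki.
by rewrite ffunE (negPf ki) mul0r.
Qed.

Lemma reflK i : involutive (refl i).
Proof.
move=> x; rewrite /refl bformBZ bform_alpha coeff1.
by apply/ffunP => k; rewrite !ffunE !scaleE; ring.
Qed.

Lemma refl_alpha i : refl i (alpha i) = - alpha i.
Proof.
rewrite /refl bform_alpha coeff1.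
by apply/ffunP => k; rewrite !ffunE !scaleE; ring.
Qed.

Lemma refl_commute i j x : m i j = 2%N -> refl i (refl j x) = refl j (refl i x).
Proof.
move=> ij; rewrite /refl !bformBZ !bform_alpha (coeff_sym j i) !coeff2 //.
by apply/ffunP => k; rewrite !ffunE !scaleE; ring.
Qed.

Lemma refl_braid i j x : m i j = 3%N ->
  refl i (refl j (refl i x)) = refl j (refl i (refl j x)).
Proof.
move=> ij; rewrite /refl !bformBZ !bform_alpha (coeff_sym j i) !coeff1 !coeff3 //.
by apply/ffunP => k; rewrite !ffunE !scaleE; ring.
Qed.

Lemma foldr_refl_cong s t x :
  cong (cox_rel m) s t -> foldr refl x s = foldr refl x t.
Proof.
move=> st; elim: st x => {s t} [u v s t st|s|s t _ IH|s t u _ IH1 _ IH2] x //.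
- rewrite !foldr_cat; congr (foldr _ _ u); move: (foldr _ _ v) => {u v x} x.
  case: st => i j; have := cox_small m i j.
  rewrite !inE => /or3P[]/eqP ij; rewrite ij /=.
  + by rewrite ((cox_diag m i j).1 ij) reflK.
  + by rewrite (refl_commute _ ij) !reflK.
  + by rewrite -(refl_braid x ij) !reflK.
- by rewrite IH1.
Qed.

Lemma cox_act_word s x : cox_act (cox_word m s) x = foldr refl x s.
Proof. exact/foldr_refl_cong/cong_repr. Qed.

Lemma cox_act1 x : cox_act 1%g x = x.
Proof. exact: (cox_act_word [::]). Qed.

Lemma cox_actM v w x : cox_act (v * w)%g x = cox_act v (cox_act w x).
Proof.
rewrite -(pres_wordK v) -(pres_wordK w) -[(_ * _)%g]cox_word_cat.
by rewrite !cox_act_word foldr_cat.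
Qed.

Definition root_set : set rootspace := [set x | exists w i, x = cox_act w (alpha i)].
Definition posroot : set rootspace := [set x | root_set x /\ forall i, 0 <= x i].
Definition negroot : set rootspace := [set x | posroot (- x)].

Lemma alpha_posroot i : alpha i \in posroot.
Proof.
rewrite inE; split; first by exists 1%g, i; rewrite cox_act1.
by move=> j; rewrite ffunE ler0n.
Qed.

Definition simple (i : I) : posroot := exist _ (alpha i) (alpha_posroot i).

Definition sends_negative (a : posroot) : pred nat := fun n =>
  `[< exists2 w : coxeter m, cox_length w = n & negroot (cox_act w (val a)) >].

Lemma sends_negative_ex a : exists n, sends_negative a n.
Proof.
have := valP a; rewrite inE => -[[w [i Ea]] _].
exists (cox_length (cox_word m [:: i] * w^-1)%g); apply/asboolP.
exists (cox_word m [:: i] * w^-1)%g => //.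
rewrite /negroot /= Ea -cox_actM -mulgA mulVg mulg1 cox_act_word /= refl_alpha.
by rewrite opprK; have := alpha_posroot i; rewrite inE.
Qed.

Definition depth (a : posroot) : nat := ex_minn (sends_negative_ex a).

Definition aut_rootspace g x : rootspace := \sum_i x i *: alpha (sgval g i).

Lemma aut_rootspaceE g x j : aut_rootspace g x (sgval g j) = x j.
Proof.
rewrite sum_ffunE (bigD1 j) //= !ffunE eqxx scaleE mulr1.
rewrite big1 ?addr0 // => i ij.
by rewrite !ffunE scaleE (inj_eq perm_inj) eq_sym (negPf ij) mulr0.
Qed.

Lemma aut_rootspace_alpha g i : aut_rootspace g (alpha i) = alpha (sgval g i).
Proof.
apply/ffunP => j; rewrite -(permKV (sgval g) j) aut_rootspaceE !ffunE.
by rewrite (inj_eq perm_inj).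
Qed.

Lemma aut_rootspace_refl g i x :
  aut_rootspace g (refl i x) = refl (sgval g i) (aut_rootspace g x).
Proof.
have -> : refl (sgval g i) (aut_rootspace g x) =
    aut_rootspace g x - bform x (alpha i) *: aut_rootspace g (alpha i).
  rewrite /refl aut_rootspace_alpha; congr (_ - _ *: _); rewrite !bformE.
  rewrite (reindex_inj (@perm_inj _ (sgval g))); apply: eq_bigr => j _.
  by rewrite aut_rootspaceE /coeff subg_coxautE.
apply/ffunP => j; rewrite -(permKV (sgval g) j).
by rewrite aut_rootspaceE /refl !ffunE !aut_rootspaceE !ffunE.
Qed.

Lemma aut_posroot_subproof g (a : posroot) :
  aut_rootspace g (val a) \in posroot.
Proof.
have := valP a; rewrite !inE => -[[w [i Ea]] a_ge0]; split=> [|j].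
  exists (cox_word m (map (sgval g) (repr w))), (sgval g i).
  rewrite cox_act_word Ea /cox_act; elim: (repr w) => [|k s IH] /=.
    exact: aut_rootspace_alpha.
  by rewrite aut_rootspace_refl IH.
by rewrite -(permKV (sgval g) j) aut_rootspaceE.
Qed.

Definition aut_posroot g (a : posroot) : posroot :=
  exist _ (aut_rootspace g (val a)) (aut_posroot_subproof g a).

End Roots.
Arguments posroot R {I} m.
Arguments alpha R {I} i.
Arguments simple R {I} m i.

(* The free module on T, as the finitely supported functions from T to K. The
   library's {malg K[T]} requires 1 != 0 in K. *)
Section FreeModule.
Variables (K : comPzRingType) (T : choiceType).

Definition fin_supp : {pred T -> K^o} :=
  fun v => `[< finite_set [set a | v a != 0] >].

Lemma fin_supp_closed : subsemimod_closed fin_supp.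
Proof.
split; first split.
- apply/asboolP; rewrite [X in finite_set X](_ : _ = set0) //.
  by apply/seteqP; split=> a //=; rewrite eqxx.
- move=> u v /asboolP Fu /asboolP Fv; apply/asboolP.
  apply: (@sub_finite_set _ _ ([set a | u a != 0] `|` [set a | v a != 0])).
    move=> a /=; have [u0|] := eqVneq (u a) 0; last by left.
    by rewrite /GRing.add /= u0 add0r; right.
  by rewrite finite_setU.
- move=> k v /asboolP Fv; apply/asboolP; apply: sub_finite_set Fv => a /=.
  by apply: contra => /eqP va0; rewrite -[_ a]/(k * v a) va0 mulr0.
Qed.

Definition freemod := {v : T -> K^o | fin_supp v}.
HB.instance Definition _ := SubChoice.on freemod.
HB.instance Definition _ :=
  GRing.SubChoice_isSubLmodule.Build K (T -> K^o) fin_supp freemod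
    fin_supp_closed.

Lemma fin_supp_basis (a : T) : fin_supp (fun b => (b == a)%:R).
Proof.
apply/asboolP/(@sub_finite_set _ _ [set a]); last exact: finite_set1.
by move=> b /=; have [->|] := eqVneq b a; rewrite ?eqxx.
Qed.

Definition basis (a : T) : freemod :=
  Sub (fun b => (b == a)%:R) (fin_supp_basis a).

Variable W : lmodType K.

Definition linext (F : T -> W) (v : freemod) : W :=
  \sum_(a \in [set: T]) val v a *: F a.

Lemma linextE F (v : freemod) (s : seq T) : uniq s ->
  (forall a, val v a != 0 -> a \in s) ->
  linext F v = \sum_(a <- s) val v a *: F a.
Proof.
move=> us sv; rewrite /linext (fsbigE s) //.
- by apply: eq_bigl => a; rewrite in_setT.
- move=> a _ as_; have [->|/sv] := eqVneq (val v a) 0; first exact: scale0r.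
  by move: as_ => /[swap] ->.
Qed.

Lemma fin_suppP (v : freemod) :
  {s | uniq s & forall a, val v a != 0 -> a \in s}.
Proof.
have /asboolP Fv := valP v; exists (finmap.enum_fset (fset_set [set a | val v a != 0])).
  exact: finmap.fset_uniq.
by move=> a va; rewrite [_ \in _](in_fset_set Fv a) inE.
Qed.

Lemma linext_is_linear F : linear (linext F).
Proof.
move=> k u v; have [s us su] := fin_suppP u; have [t ut tv] := fin_suppP v.
pose r := undup (s ++ t).
have rs a : a \in s -> a \in r by rewrite mem_undup mem_cat => ->.
have rt a : a \in t -> a \in r by rewrite mem_undup mem_cat orbC => ->.
rewrite !(@linextE _ _ r) ?undup_uniq //.
- rewrite scaler_sumr -big_split; apply: eq_bigr => a _ /=.
  by rewrite scalerA -scalerDl.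
- by move=> a /tv/rt.
- by move=> a /su/rs.
move=> a; have [ua|/su/rs//] := eqVneq (val u a) 0.
have [va|/tv/rt//] := eqVneq (val v a) 0.
by rewrite -[val _ a]/(k * val u a + val v a) ua va mulr0 addr0 eqxx.
Qed.

HB.instance Definition _ F :=
  GRing.isLinear.Build K freemod W _ (linext F) (linext_is_linear F).

Lemma linext_basis F a : linext F (basis a) = F a.
Proof.
rewrite (@linextE _ _ [:: a]) ?big_seq1 /= ?eqxx ?scale1r // => b.
by rewrite inE; apply: contraR => /negPf ->; rewrite eqxx.
Qed.

End FreeModule.

Lemma basis_sum (K : comPzRingType) (T : choiceType) (v : freemod K T) :
  v = linext (@basis K T) v.
Proof.
have [s us sv] := fin_suppP v; apply: val_inj; rewrite (linextE _ us sv).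
rewrite raddf_sum; apply/funext => a /=; rewrite fct_sumE.
transitivity (\sum_(b <- s) (\val v b : K) * (a == b)%:R); last exact: eq_bigr.
have [as_|as_] := boolP (a \in s).
  rewrite (bigD1_seq a) //= eqxx mulr1 big1 ?addr0 // => b ba.
  by rewrite eq_sym (negPf ba) mulr0.
rewrite big1_seq => [|b /andP[_ bs]].
  by apply/eqP; apply: contraNT as_ => /sv.
by case: eqP => [E|_]; rewrite ?mulr0 //; rewrite E bs in as_.
Qed.

Section Endo.
Variables (K : pzRingType) (V : lmodType K).

Definition lendo := {linear V -> V}.
HB.instance Definition _ := gen_eqMixin lendo.
HB.instance Definition _ := gen_choiceMixin lendo.

Lemma lendoP (f g : lendo) : f =1 g -> f = g.
Proof.
case: f g => f [[fD] [fZ]] [g [[gD] [gZ]]] /= /funext E.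
rewrite /= in E; case: _ / E in gD gZ *.
by rewrite (Prop_irrelevance gD fD) (Prop_irrelevance gZ fZ).
Qed.

Definition lendo1 : lendo := idfun.
Definition lendoM (f g : lendo) : lendo := f \o g.

Lemma lendoA : associative lendoM. Proof. by move=> f g h; apply: lendoP. Qed.
Lemma lendo1f : left_id lendo1 lendoM. Proof. by move=> f; apply: lendoP. Qed.
Lemma lendof1 : right_id lendo1 lendoM. Proof. by move=> f; apply: lendoP. Qed.

HB.instance Definition _ := isMonoid.Build lendo lendoA lendo1f lendof1.

End Endo.

Definition invertible (M : monoidType) (x : M) : Prop :=
  exists y : M, (x * y = 1)%g /\ (y * x = 1)%g.

(* The library's GRing.unit requires a ring with 1 != 0 and an inversion map. *)
Record ring_unit (K : comPzRingType) := RingUnit {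
  ruval :> K; ruinv : K; ruvalV : ruval * ruinv = 1 }.

Section LK.
Variables (R : realType) (I : finType) (m : coxMatrix I) (K : comPzRingType).

Definition LKmod := freemod K (posroot R m).
HB.instance Definition _ := GRing.Lmodule.on LKmod.

Definition ebasis (a : posroot R m) : LKmod := basis K a.

Definition aut_LKmod (g : [subg coxaut m]) : LKmod -> LKmod :=
  linext (fun a => ebasis (aut_posroot g a)).
HB.instance Definition _ g := GRing.Linear.on (aut_LKmod g).

Section Family.
Variables b c d : ring_unit K.

Definition LKa : K := (d : K) - (b : K) * (c : K) * ruinv d.

(* For a != alpha_i the root s_i(a) is again positive, and its depth differs from
   that of a unless s_i(a) = a; the last branch and the case of distinct roots of
   equal depth therefore never occur. *)
Definition phi_basis (i : I) (a : posroot R m) : LKmod :=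
  if a == simple R m i then 0
  else if refl m i (val a) == val a then (d : K) *: ebasis a
  else if insub (refl m i (val a)) is Some a' then
    if (depth a < depth a')%N then LKa *: ebasis a + (c : K) *: ebasis a'
    else (b : K) *: ebasis a'
  else 0.

Definition phi (i : I) : LKmod -> LKmod := linext (phi_basis i).
HB.instance Definition _ i := GRing.Linear.on (phi i).

Lemma phi_simple i : phi i (ebasis (simple R m i)) = 0.
Proof. by rewrite /phi linext_basis /phi_basis eqxx. Qed.

Lemma refl_simple_neg i (a : posroot R m) : val a != refl m i (alpha R i).
Proof.
rewrite refl_alpha; apply/eqP => E; have := valP a; rewrite inE => -[_ /(_ i)].
by rewrite E !ffunE eqxx oppr_ge0 ler10.
Qed.

Lemma phi_fixed i a : refl m i (val a) = val a ->
  phi i (ebasis a) = (d : K) *: ebasis a.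
Proof.
move=> ia; rewrite /phi linext_basis /phi_basis ia eqxx; case: eqP => // Ea.
by have := refl_simple_neg i a; rewrite -[alpha R i]/(val (simple R m i)) -Ea ia eqxx.
Qed.

Lemma phi_edge i a a' : val a' = refl m i (val a) -> (depth a < depth a')%N ->
  phi i (ebasis a') = (b : K) *: ebasis a /\
  phi i (ebasis a) = LKa *: ebasis a + (c : K) *: ebasis a'.
Proof.
move=> ia aa'; have ia' : refl m i (val a') = val a by rewrite ia reflK.
have neq : val a <> val a' by move=> /val_inj E; rewrite E ltnn in aa'.
have neq' : val a' <> val a by move/esym.
have not_simple (a1 a2 : posroot R m) : val a1 = refl m i (val a2) -> a2 <> simple R m i.
  move=> E Ea; have := refl_simple_neg i a1.
  by rewrite -[alpha R i]/(val (simple R m i)) -Ea E eqxx.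
rewrite /phi !linext_basis /phi_basis -ia ia'; split.
  case: eqP => [/(not_simple a)|_]; first by rewrite ia'.
  by case: eqP => // _; rewrite valK ltnNge (ltnW aa').
case: eqP => [/(not_simple a' _ ia)//|_].
by case: eqP => // _; rewrite valK aa'.
Qed.

Definition LK_family (f : I -> {scalar LKmod}) : Prop :=
  [/\ forall i j, i != j -> f i (ebasis (simple R m j)) = 0,
      forall i j, m i j = 2%N -> forall v, f i (phi j v) = (d : K) * f i v &
      forall i j, m i j = 3%N -> forall v, f i (phi j v) = f j (phi i v)].

Definition LK_representation (f : I -> {scalar LKmod})
    (psi : UMagmaMorphism.type (artin m) (lendo LKmod)) : Prop :=
  forall i v, psi (artin_gen m i) v = phi i v + f i v *: ebasis (simple R m i).

End Family.

Variable G : {group [subg coxaut m]}.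

Definition LKmod_fix : {pred LKmod} :=
  fun v => `[< forall g, g \in G -> aut_LKmod g v = v >].

Lemma LKmod_fix_closed : subsemimod_closed LKmod_fix.
Proof.
split; first split.
- by apply/asboolP => g _; rewrite linear0.
- move=> u v /asboolP uG /asboolP vG; apply/asboolP => g gG.
  by rewrite linearD /= (uG g gG) (vG g gG).
- move=> k v /asboolP vG; apply/asboolP => g gG.
  by rewrite linearZ /= (vG g gG).
Qed.

Definition LKmod_fixed := {v : LKmod | LKmod_fix v}.
HB.instance Definition _ := SubChoice.on LKmod_fixed.
HB.instance Definition _ :=
  GRing.SubChoice_isSubLmodule.Build K LKmod LKmod_fix LKmod_fixed
    LKmod_fix_closed.

End LK.

(* Main.v *)
(** A diagram automorphism carries words witnessing the depth of a root to words
    of the same length witnessing the depth of its image, so depth is invariant.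
    Hence [phi i] is intertwined with [phi (g i)] by [g], and with the symmetry of
    the coefficients [f i (e_a)] so are the generators of the representation.
    An inverse of an endomorphism commuting with [g] commutes with [g] as well,
    hence also restricts to the fixed points. *)
Require Import Defs.
From HB Require Import structures.
From mathcomp Require Import all_boot all_order all_fingroup all_algebra.
From mathcomp Require Import all_classical all_reals.

Set Implicit Arguments.
Unset Strict Implicit.
Unset Printing Implicit Defensive.

Import GRing.Theory.
Local Open Scope ring_scope.

(** A finitely supported [v] is a finite combination of basis vectors. This reduces the equivariance
    of [phi] and of the forms [f i] to basis vectors. *)
Lemma linear_eq_basis (K : comPzRingType) (T : choiceType) (W : lmodType K)
    (h k : {linear freemod K T -> W}) :
  (forall a, h (basis K a) = k (basis K a)) -> h =1 k.
Proof.
move=> hk v; rewrite (basis_sum v); have [s us sv] := fin_suppP v.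
rewrite (linextE _ us sv) !raddf_sum; apply: eq_bigr => a _ /=.
by rewrite !linearZ /= hk.
Qed.

Section Equivariance.
Variables (R : realType) (I : finType) (m : coxMatrix I).
Implicit Types (g : [subg coxaut m]) (a : posroot R m) (i : I).

Lemma aut_rootspaceK g : cancel (@aut_rootspace R I m g) (aut_rootspace g^-1%g).
Proof.
move=> x; apply/ffunP => j.
(* Writing [j] as the image of [g j] under the inverse of [g] gives the index the shape
   [aut_rootspaceE] expects, twice in a row. *)
by rewrite -{1}(permK (sgval g) j) -morphV ?in_setT // !aut_rootspaceE.
Qed.

Lemma aut_posrootK g : cancel (@aut_posroot R I m g) (aut_posroot g^-1%g).
Proof. by move=> a; apply: val_inj; apply: aut_rootspaceK. Qed.

Lemma aut_posroot_simple g i :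
  aut_posroot g (simple R m i) = simple R m (sgval g i).
Proof. by apply: val_inj; apply: aut_rootspace_alpha. Qed.

Lemma aut_rootspaceN g (x : rootspace R I) :
  aut_rootspace g (- x) = - aut_rootspace g x.
Proof.
by apply/ffunP => j; rewrite -(permKV (sgval g) j) !(ffunE, aut_rootspaceE).
Qed.

Lemma aut_rootspace_posroot g (x : rootspace R I) :
  x \in posroot R m -> aut_rootspace g x \in posroot R m.
Proof. by move=> x_pos; apply: (valP (aut_posroot g (exist _ x x_pos))). Qed.

Lemma aut_rootspace_negroot g (x : rootspace R I) :
  negroot m x -> negroot m (aut_rootspace g x).
Proof.
rewrite /negroot /= -aut_rootspaceN => x_neg.
by apply/set_mem/aut_rootspace_posroot/mem_set.
Qed.

Lemma aut_rootspace_foldr_refl g s (x : rootspace R I) :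
  aut_rootspace g (foldr (refl m) x s) =
  foldr (refl m) (aut_rootspace g x) (map (sgval g) s).
Proof. by elim: s => //= i s IH; rewrite aut_rootspace_refl IH. Qed.

(** With [depth_word], this makes depth the least size of a word, reduced or not, that sends [a] to
    a negative root; [g] can then act letter by letter. *)
Lemma depth_le_size a s : negroot m (foldr (refl m) (val a) s) ->
  (depth a <= size s)%N.
Proof.
move=> neg; rewrite /depth; case: ex_minnP => n _ n_min.
apply: (@leq_trans (cox_length (cox_word m s))).
  by apply/n_min/asboolP; exists (cox_word m s); rewrite ?cox_act_word.
rewrite /cox_length; case: ex_minnP => k _; apply.
by apply/asboolP; exists s.
Qed.

Lemma depth_word a :
  exists2 s, size s = depth a & negroot m (foldr (refl m) (val a) s).
Proof.
rewrite {1}/depth; case: ex_minnP => n /asboolP[w <- neg] _.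
rewrite /cox_length; case: ex_minnP => k /asboolP[s sw sk] _.
by exists s; rewrite // -cox_act_word sw.
Qed.

Lemma depth_aut_posroot g a : depth (aut_posroot g a) = depth a.
Proof.
have depth_le (h : [subg coxaut m]) (e : posroot R m) :
    (depth (aut_posroot h e) <= depth e)%N.
  have [s <- neg] := depth_word e; rewrite -(size_map (sgval h)).
  apply: depth_le_size; rewrite -aut_rootspace_foldr_refl.
  exact: aut_rootspace_negroot.
(* The reverse inequality is the same one for the inverse of [g], applied to the image of [a]. *)
by apply/eqP; rewrite eqn_leq depth_le -{1}(aut_posrootK g a) depth_le.
Qed.

Variables (K : comPzRingType) (b c d : ring_unit K).

Lemma aut_LKmod_basis g a :
  aut_LKmod g (ebasis K a) = ebasis K (aut_posroot g a).
Proof. exact: linext_basis. Qed.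

(** Each test in [phi_basis] (being simple, being fixed, positivity, comparison of depths) has the
    same outcome after applying [g], so both sides take the same branch. *)
Lemma aut_LKmod_phi_basis g i a :
  aut_LKmod g (phi_basis b c d i a) =
  phi_basis b c d (sgval g i) (aut_posroot g a).
Proof.
have injP := can_inj (aut_posrootK g); have injR := can_inj (aut_rootspaceK g).
rewrite /phi_basis -aut_posroot_simple (inj_eq injP) /= -aut_rootspace_refl.
rewrite (inj_eq injR).
case: ifP => _; first exact: linear0.
case: ifP => _; first by rewrite linearZ /= aut_LKmod_basis.
case: insubP => [a' _ <-|nonpos].
  rewrite -[aut_rootspace g (val a')]/(val (aut_posroot g a')) valK.
  rewrite !depth_aut_posroot; case: ifP => _.
    by rewrite linearD !linearZ /= !aut_LKmod_basis.
  by rewrite linearZ /= aut_LKmod_basis.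
(* Both sides are 0 here: were the image of the reflected vector a positive root, the inverse of [g]
   would make the vector itself one. *)
rewrite linear0 insubN //; apply: contra nonpos => pos.
by rewrite -(aut_rootspaceK g (refl m i _)) aut_rootspace_posroot.
Qed.

Lemma aut_LKmod_phi g i (v : LKmod R m K) :
  aut_LKmod g (phi b c d i v) = phi b c d (sgval g i) (aut_LKmod g v).
Proof.
apply: (@linear_eq_basis _ _ _ (aut_LKmod g \o phi b c d i)
                        (phi b c d (sgval g i) \o aut_LKmod g)) => a /=.
rewrite -[basis K a]/(ebasis K a) aut_LKmod_basis [in RHS]/phi linext_basis.
by rewrite /phi linext_basis aut_LKmod_phi_basis.
Qed.

Variables (f : I -> {scalar (LKmod R m K)})
  (psi : UMagmaMorphism.type (artin m) (lendo (LKmod R m K))).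
Hypothesis psiE : LK_representation b c d f psi.

Lemma aut_LKmod_psi g :
    (forall i a, f i (ebasis K a) = f (sgval g i) (ebasis K (aut_posroot g a))) ->
  forall x v, aut_LKmod g (psi x v) = psi (aut_artin g x) (aut_LKmod g v).
Proof.
move=> fg x; rewrite -(pres_wordK x) aut_artin_word.
have fgE i v : f i v = f (sgval g i) (aut_LKmod g v).
  apply: (@linear_eq_basis _ _ K^o (f i) (f (sgval g i) \o aut_LKmod g)) => a /=.
  by rewrite -[basis K a]/(ebasis K a) aut_LKmod_basis.
(* Induction on a word for [x], for all [v]: the first letter is split off, and the induction
   hypothesis serves both inside [phi i] and inside [f i]. *)
elim: (generic_quotient.repr x) => [|i s IH] v /=.
  by rewrite -[pres_word _ _]/(1%g : artin m) gmulf1.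
rewrite -cat1s -[_ :: map _ _]cat1s !pres_word_cat.
rewrite -!/(artin_gen m _) !gmulfM /= !psiE.
by rewrite linearD linearZ /= aut_LKmod_phi IH fgE IH aut_LKmod_basis
  aut_posroot_simple.
Qed.

End Equivariance.

Section Restriction.
Variables (K : pzRingType) (V : lmodType K) (S : {pred V})
  (U : subLmodType S).

Definition stable (h : lendo V) := forall v, S v -> S (h v).

Section Map.
Variables (h : lendo V) (hS : stable h).

(** Stated for any stable endomorphism, so as to apply both to the maps [psi x] and to their
    inverses. *)
Definition restr_fun (u : U) : U := Sub (h (val u)) (hS (valP u)).

Lemma restr_fun_linear : linear restr_fun.
Proof. by move=> k u v; apply: val_inj; rewrite linearP /= !SubK !linearP. Qed.

HB.instance Definition _ :=
  GRing.isLinear.Build K U U _ restr_fun restr_fun_linear.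

Definition restr : lendo U := restr_fun.

Lemma val_restr u : val (restr u) = h (val u).
Proof. exact: SubK. Qed.

End Map.
End Restriction.

Theorem proposition46 (R : realType) (I : finType) (m : coxMatrix I)
    (G : {group [subg (coxaut m)]}) (K : comPzRingType) (b c d : ring_unit K)
    (f : I -> {scalar (LKmod R m K)})
    (psi : UMagmaMorphism.type (artin m) (lendo (LKmod R m K))) :
  LK_family b c d f ->
  LK_representation b c d f psi ->
  (forall (i : I) (a : posroot R m) (g : [subg (coxaut m)]), g \in G ->
    f i (ebasis K a) = f (sgval g i) (ebasis K (aut_posroot g a))) ->
  [/\ forall (x : artin m) (v : LKmod R m K) (g : [subg (coxaut m)]), g \in G ->
        aut_LKmod g (psi x v) = psi (aut_artin g x) (aut_LKmod g v),
      forall x : artin m, artin_fix G x ->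
        forall v : LKmod R m K, LKmod_fix G v -> LKmod_fix G (psi x v) &
      exists psiG :
          UMagmaMorphism.type (artin_fixed G) (lendo (LKmod_fixed R K G)),
        (forall (x : artin_fixed G) (v : LKmod_fixed R K G),
          val (psiG x v) = psi (val x) (val v)) /\
        ((forall x : artin m, invertible (psi x)) ->
          forall x : artin_fixed G, invertible (psiG x))].
Proof.
move=> _ psiE fG.
have equiv x v g : g \in G ->
    aut_LKmod g (psi x v) = psi (aut_artin g x) (aut_LKmod g v).
  by move=> gG; apply: (aut_LKmod_psi psiE) => i a; apply: fG.
(* Commutation holds on all of V, not only on fixed vectors; the argument for inverses relies on
   this. *)
have commute x v g : artin_fix G x -> g \in G ->
    aut_LKmod g (psi x v) = psi x (aut_LKmod g v).
  by move=> /asboolP xG gG; rewrite equiv // (xG g gG).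
have stab x : artin_fix G x -> stable (@LKmod_fix R I m K G) (psi x).
  move=> xG v /asboolP vG; apply/asboolP => g gG.
  by rewrite commute // (vG g gG).
pose F (x : artin_fixed G) : lendo (LKmod_fixed R K G) :=
  restr (LKmod_fixed R K G) (stab (val x) (valP x)).
have FE x v : val (F x v) = psi (val x) (val v) by apply: val_restr.
have Fmorph : monoid.monoid_morphism F.
  split=> [|x y]; apply: lendoP => v; apply: val_inj; rewrite FE.
    by rewrite !gmulf1.
  have -> : val (x * y)%g = (val x * val y)%g by apply: gmulfM.
  by rewrite -[(F x * F y)%g v]/(F x (F y v)) !FE gmulfM.
pose FM := isUMagmaMorphism.Build _ _ F Fmorph.
pose psiG : UMagmaMorphism.type _ _ := HB.pack F FM.
split=> //; exists psiG; split=> // inv x.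
have [y [xy yx]] := inv (val x).
have xyE v : psi (val x) (y v) = v by move/(congr1 (fun h : lendo _ => h v)): xy.
have yxE v : y (psi (val x) v) = v by move/(congr1 (fun h : lendo _ => h v)): yx.
(* The inverse [y] is just some endomorphism, perhaps not an image of [psi]. For fixed [v], with [p]
   standing for [psi (val x)]: g (y v) = y (p (g (y v))) = y (g (p (y v))) = y (g v) = y v. *)
have y_stab : stable (@LKmod_fix R I m K G) y.
  move=> v /asboolP vG; apply/asboolP => g gG.
  by rewrite -[LHS]yxE -commute ?xyE ?(vG g gG) //; apply: (valP x).
exists (restr (LKmod_fixed R K G) y_stab).
split; apply: lendoP => v; apply: val_inj.
  by rewrite FE val_restr xyE.
by rewrite val_restr FE yxE.
Qed.
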